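(* Let $X_1,\dots,X_{n}$ and $Y$ be Banach spaces, $X:= X_1 \times \cdots \times X_n$ and $G \subset X$ an open set. Suppose that each space $\mathcal{L}(\tilde X_i, \tilde Y)$ is separable whenever $\tilde X_i$ is a separable subspace of $X_i$, $i=1,\dots, n-1$, and $\tilde Y$ is a separable subspace of $Y$. Let $f:G \to Y$ be a continuous (resp. Lipschitz) mapping. Then there exists a first category (resp. $\sigma$-porous) set $A \subset G$ such that, for each $x \in G \setminus A$, the following implication holds: if $f$ has all Fréchet partial derivatives $f'_1(x),\dots,f'_n(x)$ at $x$, then $f$ is Fréchet differentiable at $x$.
   Context: All Banach spaces are real and nontrivial ($\neq\{0\}$), with norm denoted $|\cdot|$. A subspace of a Banach space means a closed linear subspace $\neq\{0\}$. $X_1\times\cdots\times X_n$ is equipped with the maximum norm. $\mathcal{L}(V,W)$ is the Banach space of continuous linear mappings $V\to W$ with the operator norm. $B(x,r)$ is the open ball. For $x=(x_1,\dots,x_n)\in G$, the partial Fréchet derivative $f'_i(x)\in\mathcal{L}(X_i,Y)$ is (if it exists) the Fréchet derivative at $x_i$ of the mapping $t\mapsto f(x_1,\dots,x_{i-1},t,x_{i+1},\dots,x_n)$, defined for those $t\in X_i$ for which the argument lies in $G$. A first category (meagre) set is a countable union of nowhere dense sets. A set $A\subset X$ is porous at $x\in X$ if there exists $c>0$ such that for each $\delta>0$ there exists $t\in B(x,\delta)\setminus\{x\}$ with $B(t,c|t-x|)\cap A=\emptyset$. $A$ is porous if it is porous at each of its points, and $\sigma$-porous if it is a countable union of porous sets.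 *)

(* Defs.v *)
From HB Require Import structures.
From mathcomp Require Import all_boot all_order all_algebra.
From mathcomp Require Import all_classical all_reals all_analysis.

Set Implicit Arguments.
Unset Strict Implicit.
Unset Printing Implicit Defensive.

Import Order.TTheory GRing.Theory Num.Theory.
Import numFieldNormedType.Exports.

Local Open Scope classical_set_scope.
Local Open Scope ring_scope.

Definition maxprod (R : realType) (I : finType) (X : I -> normedModType R)
  : Type := forall i, X i.

Section MaxProd.
Context (R : realType) (I : finType) (X : I -> normedModType R).
Local Notation E := (maxprod X).
Implicit Types x y z : E.

HB.instance Definition _ := gen_eqMixin E.
HB.instance Definition _ := gen_choiceMixin E.

Definition maxprod_zero : E := fun i => 0.
Definition maxprod_opp x : E := fun i => - x i.
Definition maxprod_add x y : E := fun i => x i + y i.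
Definition maxprod_scale (a : R) x : E := fun i => a *: x i.

Fact maxprod_addA : associative maxprod_add.
Proof. by move=> x y z; apply: functional_extensionality_dep => i; apply: addrA. Qed.

Fact maxprod_addC : commutative maxprod_add.
Proof. by move=> x y; apply: functional_extensionality_dep => i; apply: addrC. Qed.

Fact maxprod_add0 : left_id maxprod_zero maxprod_add.
Proof. by move=> x; apply: functional_extensionality_dep => i; apply: add0r. Qed.

Fact maxprod_addN : left_inverse maxprod_zero maxprod_opp maxprod_add.
Proof. by move=> x; apply: functional_extensionality_dep => i; apply: addNr. Qed.

HB.instance Definition _ := GRing.isZmodule.Build E
  maxprod_addA maxprod_addC maxprod_add0 maxprod_addN.

Fact maxprod_scaleA a b x :
  maxprod_scale a (maxprod_scale b x) = maxprod_scale (a * b) x.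
Proof. by apply: functional_extensionality_dep => i; apply: scalerA. Qed.

Fact maxprod_scale1 : left_id 1 maxprod_scale.
Proof. by move=> x; apply: functional_extensionality_dep => i; apply: scale1r. Qed.

Fact maxprod_scaleDr : right_distributive maxprod_scale +%R.
Proof. by move=> a x y; apply: functional_extensionality_dep => i; apply: scalerDr. Qed.

Fact maxprod_scaleDl x : {morph maxprod_scale^~ x : a b / a + b}.
Proof. by move=> a b; apply: functional_extensionality_dep => i; apply: scalerDl. Qed.

HB.instance Definition _ := GRing.Zmodule_isLmodule.Build R E
  maxprod_scaleA maxprod_scale1 maxprod_scaleDr maxprod_scaleDl.

Definition maxprod_norm x : R := \big[Num.max/0]_(i : I) `|x i|.

Fact le_maxprod_norm x i : `|x i| <= maxprod_norm x.
Proof. exact: le_bigmax. Qed.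

Fact maxprod_normD x y :
  maxprod_norm (x + y) <= maxprod_norm x + maxprod_norm y.
Proof.
apply: bigmax_le => [|i _]; first by rewrite addr_ge0// bigmax_ge_id.
by rewrite (le_trans (ler_normD _ _))// lerD// le_maxprod_norm.
Qed.

Fact maxprod_normZ a x : maxprod_norm (a *: x) = `|a| * maxprod_norm x.
Proof.
rewrite /maxprod_norm.
elim/big_rec2: _ => [|i u v _ ->]; first by rewrite mulr0.
by rewrite maxr_pMr// -normrZ.
Qed.

Fact maxprod_norm0_eq0 x : maxprod_norm x = 0 -> x = 0.
Proof.
move=> x0; apply: functional_extensionality_dep => i; apply/eqP.
by rewrite -normr_le0 -x0 le_maxprod_norm.
Qed.

HB.instance Definition _ := Lmodule_isNormed.Build R E
  maxprod_normD maxprod_normZ maxprod_norm0_eq0.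

End MaxProd.

Record subspace_of (R : realType) (V : normedModType R) := SubspaceOf {
  subspace_set :> set V ;
  subspace_closed : closed subspace_set ;
  subspace_set0 : subspace_set 0 ;
  subspace_setD : forall x y,
    subspace_set x -> subspace_set y -> subspace_set (x + y) ;
  subspace_setZ : forall (a : R) x, subspace_set x -> subspace_set (a *: x) ;
  subspace_neq0 : exists2 x, subspace_set x & x != 0 }.

Section Subspace.
Context (R : realType) (V : normedModType R) (S : subspace_of V).

Definition in_subspace : {pred V} := fun x => `[< subspace_set S x >].

Fact in_subspace_submod : subsemimod_closed in_subspace.
Proof.
split; first split.
- exact/asboolP/subspace_set0.
- by move=> x y /asboolP Sx /asboolP Sy; apply/asboolP/subspace_setD.
- by move=> a x /asboolP Sx; apply/asboolP/subspace_setZ.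
Qed.

HB.instance Definition _ := GRing.isSubmodClosed.Build R V in_subspace
  in_subspace_submod.

Definition subspace_type : Type := {x : V | x \in in_subspace}.

HB.instance Definition _ := SubChoice.on subspace_type.
HB.instance Definition _ := [SubChoice_isSubLmodule of subspace_type by <:].

Definition subspace_norm (x : subspace_type) : R := `|val x|.

Fact subspace_normD x y :
  subspace_norm (x + y) <= subspace_norm x + subspace_norm y.
Proof. exact: ler_normD. Qed.

Fact subspace_normZ a x : subspace_norm (a *: x) = `|a| * subspace_norm x.
Proof. exact: normrZ. Qed.

Fact subspace_norm0_eq0 x : subspace_norm x = 0 -> x = 0.
Proof. by move=> /normr0_eq0 x0; apply: val_inj. Qed.

HB.instance Definition _ := Lmodule_isNormed.Build R subspace_type
  subspace_normD subspace_normZ subspace_norm0_eq0.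

End Subspace.

Section ContinuousLinear.
Context (R : realType) (V W : normedModType R).

Definition in_clinear : {pred V -> W} :=
  fun f => `[< linear f /\ continuous f >].

Fact in_clinear_submod : subsemimod_closed in_clinear.
Proof.
split; first split.
- apply/asboolP; split; last exact: cst_continuous.
  by move=> a x y; rewrite /= scaler0 addr0.
- move=> f g /asboolP[fl fc] /asboolP[gl gc]; apply/asboolP; split.
    by move=> a x y; rewrite !fctE fl gl scalerDr addrACA.
  by move=> x; apply: continuousD; [exact: fc|exact: gc].
- move=> b f /asboolP[fl fc]; apply/asboolP; split.
    by move=> a x y; rewrite !fctE fl scalerDr !scalerA mulrC.
  by move=> x; apply: cvgZl_tmp; exact: fc.
Qed.

HB.instance Definition _ := GRing.isSubmodClosed.Build R (V -> W) in_clinear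
  in_clinear_submod.

Definition clinear : Type := {f : V -> W | f \in in_clinear}.

HB.instance Definition _ := SubChoice.on clinear.
HB.instance Definition _ := [SubChoice_isSubLmodule of clinear by <:].

Definition opnorm (T : clinear) : R :=
  sup [set `|val T x| | x in [set x : V | `|x| <= 1]].

Fact clinear_linear (T : clinear) : linear (val T).
Proof. by have /asboolP[] := valP T. Qed.

Fact clinear_continuous (T : clinear) : continuous (val T).
Proof. by have /asboolP[] := valP T. Qed.

Fact opnorm_has_sup (T : clinear) :
  has_sup [set `|val T x| | x in [set x : V | `|x| <= 1]].
Proof.
pose L := GRing.isLinear.Build R V W _ (val T) (clinear_linear T).
pose T' : {linear V -> W} := HB.pack (val T) L.
split; first by exists `|val T 0|; exists 0 => //=; rewrite normr0 ler01.
have /linear_boundedP : bounded_near T' (nbhs (0 : V)).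
  by apply: continuous_linear_bounded; exact: clinear_continuous.
move=> /pinfty_ex_gt0[r r0 Tr]; exists r => _ [x x1 <-].
by rewrite (le_trans (Tr x))// ler_piMr// ltW.
Qed.

Fact le_opnorm (T : clinear) (x : V) : `|x| <= 1 -> `|val T x| <= opnorm T.
Proof.
move=> x1; apply: ub_le_sup; last by exists x.
by have [] := opnorm_has_sup T.
Qed.

Fact opnorm_le (T : clinear) (M : R) :
  (forall x, `|x| <= 1 -> `|val T x| <= M) -> opnorm T <= M.
Proof.
move=> TM; apply: ge_sup; first by have [] := opnorm_has_sup T.
by move=> _ [x x1 <-]; exact: TM.
Qed.

Fact opnorm_ge0 T : 0 <= opnorm T.
Proof. by rewrite (le_trans (normr_ge0 (val T 0)))// le_opnorm// normr0. Qed.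

Fact opnormD T U : opnorm (T + U) <= opnorm T + opnorm U.
Proof.
apply: opnorm_le => x x1; rewrite (le_trans (ler_normD _ _))//.
by rewrite lerD// le_opnorm.
Qed.

Fact opnormZ_le a T : opnorm (a *: T) <= `|a| * opnorm T.
Proof.
apply: opnorm_le => x x1.
by rewrite (_ : val (a *: T) x = a *: val T x)// normrZ ler_wpM2l// le_opnorm.
Qed.

Fact opnormZ a T : opnorm (a *: T) = `|a| * opnorm T.
Proof.
apply/eqP; rewrite eq_le opnormZ_le/=.
have [->|a0] := eqVneq a 0; first by rewrite normr0 mul0r opnorm_ge0.
rewrite -ler_pdivlMl ?normr_gt0// -normfV.
by have := opnormZ_le a^-1 (a *: T); rewrite scalerA mulVf// scale1r.
Qed.

Fact opnorm0_eq0 T : opnorm T = 0 -> T = 0.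
Proof.
move=> T0; apply: val_inj; apply/funext => x /=; apply/eqP.
have T00 : val T 0 = 0.
  by have := clinear_linear T (-1) 0 0; rewrite scaler0 addr0 scaleN1r addNr.
have [->|x0] := eqVneq x 0; first by rewrite T00.
have : `|val T (`|x|^-1 *: x)| <= 0.
  rewrite -T0 le_opnorm// normrZ normfV normr_id mulVf//.
  by rewrite normr_eq0.
have := clinear_linear T `|x|^-1 x 0; rewrite !addr0 T00 addr0 => ->.
by rewrite normr_le0 scaler_eq0 invr_eq0 normr_eq0 (negbTE x0).
Qed.

HB.instance Definition _ := Lmodule_isNormed.Build R clinear
  opnormD opnormZ opnorm0_eq0.

End ContinuousLinear.

Definition separable (T : topologicalType) :=
  exists2 D : set T, countable D & dense D.

Definition nowhere_dense (T : topologicalType) (A : set T) :=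
  (closure A)° = set0.

Definition first_category (T : topologicalType) (A : set T) :=
  exists2 F : (set T)^nat, forall k, nowhere_dense (F k) & A = \bigcup_k F k.

Section Porosity.
Context (R : realType) (V : normedModType R).

Definition porous_at (A : set V) (x : V) :=
  exists2 c : R, 0 < c & forall delta : R, 0 < delta ->
    exists t : V, [/\ ball x delta t, t != x &
      ball t (c * `|t - x|) `&` A = set0].

Definition porous (A : set V) := forall x, A x -> porous_at A x.

Definition sigma_porous (A : set V) :=
  exists2 F : (set V)^nat, forall k, porous (F k) & A = \bigcup_k F k.

End Porosity.

(* A mapping defined on an open set G is represented by a total function f    *)
(* whose values outside G are irrelevant: at x in G, dfwith x i t lies in G   *)
(* for t near x i, and differentiability only depends on such t.              *)
Definition partially_differentiable (R : realType) (I : finType)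
    (X : I -> normedModType R) (Y : normedModType R)
    (f : maxprod X -> Y) (i : I) (x : maxprod X) :=
  differentiable (fun t : X i => f (dfwith x i t)) (x i).

(* Main.v *)
(* Sets with holes near each of their points generate, for both notions of    *)
(* smallness, a sigma-ideal in which being locally small implies being small. *)
(* Suppose the points x where f has a partial derivative L_x in the direction *)
(* of X_i that is not strong (the first order expansion of f along X_i is not *)
(* uniform over base points near x) do not form a small set. After a          *)
(* countable decomposition, points whose L_x are close to a given operator do *)
(* form a set with holes, so L_x must oscillate on every non-small piece.     *)
(* This gives a binary tree of non-small pieces, on which L differs at        *)
(* vectors u_s. The tree involves countably many points and vectors, hence    *)
(* separable closed spans in X_i and Y; choosing at level j the branch that   *)
(* avoids the j-th element of a dense sequence of operators between these     *)
(* spans, the derivatives along the branch converge to an operator far from   *)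
(* every element of the dense sequence, a contradiction. Off the exceptional  *)
(* set, adding up increments one coordinate at a time, the last one first,    *)
(* gives differentiability.                                                   *)

From HB Require Import structures.
Require Import Defs.
From mathcomp Require Import all_boot all_order all_algebra.
From mathcomp Require Import all_classical all_reals all_analysis.
From mathcomp Require Import ring lra.

Set Implicit Arguments.
Unset Strict Implicit.
Unset Printing Implicit Defensive.

Import Order.TTheory GRing.Theory Num.Theory.
Import numFieldNormedType.Exports.

Local Open Scope classical_set_scope.
Local Open Scope ring_scope.

(** * Sigma-ideals of sets with holes *)

(** Both cases use one notion of smallness, [sigma_holey strong]. The heart is [not_strong_small]:
    in a direction with the separability property, the points with a partial derivative that is not
    strong form a small set. [strong_partials_differentiable] then gives differentiability off these
    sets.

    If strongness fails at [x], then for some [e] there are [t] near [x] and small [h] for which the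
    increment of [f] at [t] misses [L x h] by more than [e * (|h| + |t - x|)]. By [stable_radius]
    the increment hardly changes on a ball around [t]. A point [y] of that ball with a good
    expansion of its own and with [L y] close to [L x] would contradict the failure, so the ball is
    a hole in the class of such [y].

    Were the operators to lie in a separable space, countably many classes would do. Only operators
    between separable subspaces do so, and [sigma_holey_of_classes] is the separable reduction: if
    each class of nearly equal derivatives is small, so is the whole set. *)

Lemma exists_invSn_lt (R : realType) (e : R) :
  0 < e -> exists n, n.+1%:R^-1 < e.
Proof.
by move=> e0; have [n] := ltr_add_invr e0; rewrite add0r => ?; exists n.
Qed.

Section Holey.
Context (R : realType) (V : normedModType R).
Implicit Types (strong : bool) (A B : set V).

(* Common form of the two notions of smallness: [holey true] is porosity and  *)
(* [holey false] is nowhere density.                                          *)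
Definition holey strong A := forall x, A x ->
  exists2 c : R, 0 < c & forall d : R, 0 < d -> exists t r,
    [/\ `|t - x| < d, 0 < r <= `|t - x|, strong -> c * `|t - x| <= r &
        forall y, `|y - t| < r -> ~ A y].

Definition sigma_holey strong A :=
  exists2 F : (set V)^nat, forall k, holey strong (F k) & A = \bigcup_k F k.

Lemma holeyS strong A B : A `<=` B -> holey strong B -> holey strong A.
Proof.
move=> AB hB x /AB/hB[c c0 hc]; exists c => // d /hc[t [r [td r0 cr nB]]].
by exists t, r; split=> // y /nB + /AB.
Qed.

Lemma holey_porous A : holey true A -> porous A.
Proof.
move=> hA x /hA[c c0 hc]; exists c => // d /hc[t [r [td /andP[r0 rt] cr nA]]].
exists t; split.
- by rewrite -ball_normE /= distrC.
- by rewrite -subr_eq0 -normr_gt0 (lt_le_trans r0).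
- rewrite -subset0 => y [+ Ay]; rewrite -ball_normE /= distrC => yt.
  by apply: nA Ay; exact: lt_le_trans yt (cr isT).
Qed.

(** If the closure contained a ball, [A] would be dense in it; but a point of [A] near the centre
    has a hole whose centre still lies in that ball. *)
Lemma holey_nowhere_dense strong A : holey strong A -> nowhere_dense A.
Proof.
move=> hA; rewrite /nowhere_dense -subset0 => x /= Ax.
have [e e0 xe] : exists2 e : R, 0 < e & forall y, `|y - x| < e -> closure A y.
  move/nbhs_interior : Ax => /nbhs_normP[e e0 he]; exists e => // y yx.
  by apply: interior_subset; apply: he; rewrite /= distrC.
have nearA y (d : R) : 0 < d -> closure A y -> exists2 z, A z & `|z - y| < d.
  move=> d0 /(_ (ball y d) (nbhsx_ballx _ _ d0))[z [Az]].
  by rewrite -ball_normE /= distrC => ?; exists z.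
have [z Az zx] : exists2 z, A z & `|z - x| < e / 2.
  by apply: nearA; [rewrite divr_gt0|apply: xe; rewrite subrr normr0].
have [c c0 /(_ (e / 2))[|t [r [tz /andP[r0 _] _ nA]]]] := hA _ Az.
  by rewrite divr_gt0.
have [w Aw wt] : exists2 w, A w & `|w - t| < r.
  apply: nearA => //; apply: xe.
  rewrite -(subrK z t) -addrA (le_lt_trans (ler_normD _ _))//.
  by rewrite [e]splitr ltrD.
exact: nA Aw.
Qed.

(** Because [r] is at most the distance from [t] to [x], a hole with centre within [e / 2] of [x]
    stays within [e] of [x], where separation excludes all other members. *)
Lemma holey_bigcup_separated strong (I : Type) (F : I -> set V) (e : R) :
  0 < e -> (forall i j x y, F i x -> F j y -> `|x - y| < e -> i = j) ->
  (forall i, holey strong (F i)) -> holey strong (\bigcup_i F i).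
Proof.
move=> e0 sep hF x [i _ Fx]; have [c c0 hc] := hF _ _ Fx.
exists c => // d d0; have [|t [r [td /andP[r0 rt] cr nF]]] := hc (Num.min d (e / 2)).
  by rewrite lt_min d0 divr_gt0.
move: td; rewrite lt_min => /andP[td te].
exists t, r; split; rewrite ?r0// => y yt [j _ Fy].
suff ij : i = j by apply: nF yt _; rewrite ij.
apply: sep Fx Fy _; rewrite distrC -(subrK t y) -addrA.
rewrite (le_lt_trans (ler_normD _ _))// [e]splitr ltrD//.
by rewrite (lt_trans (lt_le_trans yt rt)).
Qed.

Lemma sigma_holeyS strong A B :
  A `<=` B -> sigma_holey strong B -> sigma_holey strong A.
Proof.
move=> AB [F hF BE]; exists (fun k => A `&` F k).
  by move=> k; apply: holeyS (hF k).
by rewrite -setI_bigcupr -BE setIidl.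
Qed.

Lemma holey_sigma strong A : holey strong A -> sigma_holey strong A.
Proof. by move=> hA; exists (fun=> A) => //; rewrite bigcup_const. Qed.

Lemma sigma_holey_bigcup strong (F : (set V)^nat) :
  (forall k, sigma_holey strong (F k)) -> sigma_holey strong (\bigcup_k F k).
Proof.
move=> /(_ _)/cid2-/all_sig2[H hH FE].
exists (fun n => if unpickle n is Some (i, j) then H i j else set0).
  by move=> k; case: unpickle => [[i j]|//]; exact: hH.
rewrite predeqE => x; split.
- move=> [i _]; rewrite FE => -[j _ Hx]; exists (pickle (i, j)) => //.
  by rewrite pickleK.
- move=> [n _]; case: unpickle => [[i j] Hx|//]; exists i => //.
  by rewrite FE; exists j.
Qed.

Lemma sigma_holeyU strong A B :
  sigma_holey strong A -> sigma_holey strong B -> sigma_holey strong (A `|` B).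
Proof.
move=> sA sB; apply: (@sigma_holeyS _ _
  (\bigcup_n (if n is 0 then A else B))); last first.
  by apply: sigma_holey_bigcup => -[].
by move=> x [Ax|Bx]; [exists 0%N|exists 1%N].
Qed.

(* Stone's trick: well-order the balls and attach each point to the first     *)
(* ball containing it; the points lying [1/(n+1)]-deep in their ball form a   *)
(* separated family indexed by the balls.                                     *)
Lemma sigma_holey_local strong A :
  (forall x, A x -> exists2 r : R, 0 < r &
     sigma_holey strong (A `&` [set y | `|y - x| < r])) ->
  sigma_holey strong A.
Proof.
move=> locA.
have [rho rhoP] : {rho : V -> R & forall x, A x -> 0 < rho x /\
    sigma_holey strong (A `&` [set y | `|y - x| < rho x])}.
  apply: (@choice _ _ (fun x (r : R) => A x -> 0 < r /\
    sigma_holey strong (A `&` [set y | `|y - x| < r]))) => x.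
  by have [/locA[r]|nAx] := pselect (A x); [exists r|exists 0].
have [F FP] : {F : V -> (set V)^nat & forall x, A x ->
    (forall k, holey strong (F x k)) /\
    A `&` [set y | `|y - x| < rho x] = \bigcup_k F x k}.
  apply: (@choice _ _ (fun x (F : (set V)^nat) => A x -> (forall k, holey strong (F k)) /\
    A `&` [set y | `|y - x| < rho x] = \bigcup_k F k)) => x.
  by have [/rhoP[_ [F]]|nAx] := pselect (A x); [exists F|exists (fun=> set0)].
have [le wole] := wochoice.well_ordering_principle V.
have le_anti : antisymmetric le.
  have wochain := wochoice.withinW wole : wochoice.wo_chain le predT.
  by move=> x y; exact: (wochoice.wo_chain_antisymmetric wochain).
pose first x z := [/\ A z, `|x - z| < rho z &
  forall w, A w -> `|x - w| < rho w -> le z w].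
pose E n z := [set x | [/\ A x, first x z &
  forall y, `|y - x| < n.+1%:R^-1 -> `|y - z| < rho z]].
have -> : A = \bigcup_n \bigcup_k \bigcup_z (E n z `&` F z k).
  rewrite predeqE => x; split; last by move=> [n _] [k _] [z _] [[]].
  move=> Ax.
  have [z [[] ]] : exists! z, wochoice.minimum_of le
      (fun z => `[< A z /\ `|x - z| < rho z >]) z.
    apply: wole; exists x; apply/asboolP; split=> //.
    by rewrite subrr normr0; have [] := rhoP _ Ax.
  move=> /asboolP[Az xz] zmin _.
  have [n nP] : exists n, n.+1%:R^-1 < rho z - `|x - z|.
    by apply: exists_invSn_lt; rewrite subr_gt0.
  have : (A `&` [set y | `|y - z| < rho z]) x by [].
  have [_ ->] := FP _ Az => -[k _ Fx].
  exists n => //; exists k => //; exists z => //; split=> //; split=> //.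
    by split=> // w Aw xw; apply: zmin; apply/asboolP.
  move=> y yx; rewrite -(subrK x y) -addrA (le_lt_trans (ler_normD _ _))//.
  by rewrite -ltrBrDr (lt_trans yx).
apply: sigma_holey_bigcup => n; apply: sigma_holey_bigcup => k.
apply: holey_sigma; apply: (@holey_bigcup_separated _ _ _ n.+1%:R^-1) => //.
  move=> z w x y [[_ [Az xz zmin] deepx] _] [[_ [Aw yw wmin] deepy] _] xy.
  apply: le_anti; apply/andP; split.
    by apply: zmin => //; exact: deepy.
  by apply: wmin => //; apply: deepx; rewrite distrC.
move=> z; have [Az|nAz] := pselect (A z).
  have [/(_ k) hF _] := FP _ Az.
  by apply: holeyS hF => x [].
by move=> x [[_ [/nAz]]].
Qed.

(** The points where [A] is locally small form a small set by [sigma_holey_local], so removing them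
    costs nothing. At each remaining point every neighbourhood carries a non-small piece of [A],
    which allows the branching of the tree. *)
Lemma sigma_holey_kernel strong A : ~ sigma_holey strong A ->
  ~ sigma_holey strong (A `&` [set x | forall r : R, 0 < r ->
      ~ sigma_holey strong (A `&` [set y | `|y - x| < r])]).
Proof.
move=> nA sK; apply: nA.
pose B := A `&` [set x | exists2 r : R, 0 < r &
  sigma_holey strong (A `&` [set y | `|y - x| < r])].
have sB : sigma_holey strong B.
  apply: sigma_holey_local => x [_ [r r0 sr]]; exists r => //.
  by apply: sigma_holeyS sr => y [[]].
apply: sigma_holeyS (sigma_holeyU sK sB) => x Ax.
have [Bx|nBx] := pselect (B x); [by right|left; split=> // r r0 sr].
by apply: nBx; split=> //; exists r.
Qed.

End Holey.

(** * Separable closed spans *)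

Section ClosedSpan.
Context (R : realType) (V : normedModType R) (J : countType) (u : J -> V).

(** Rational coefficients make the index type of lists countable, so these combinations are a
    countable dense subset of their closure. *)
Definition ratcomb (l : seq (rat * J)) : V :=
  \sum_(p <- l) ratr p.1 *: u p.2.

Definition closed_span_set : set V := closure (range ratcomb).

Lemma closed_span_setP x : closed_span_set x <->
  forall e : R, 0 < e -> exists l, `|x - ratcomb l| < e.
Proof.
split=> [+ e e0|near B /nbhs_normP[e e0 eB]].
  move=> /(_ (ball x e) (nbhsx_ballx _ _ e0))[_ [[l _ <-]]].
  by rewrite -ball_normE; exists l.
by have [l xl] := near _ e0; exists (ratcomb l); split; [exists l|exact: eB].
Qed.

Lemma closed_span_set0 : closed_span_set 0.
Proof.
by apply/closed_span_setP => e e0; exists [::]; rewrite /ratcomb big_nil subrr normr0.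
Qed.

Lemma closed_span_setD x y :
  closed_span_set x -> closed_span_set y -> closed_span_set (x + y).
Proof.
move=> /closed_span_setP sx /closed_span_setP sy.
apply/closed_span_setP => e e0; have e20 : 0 < e / 2 by rewrite divr_gt0.
have [l xl] := sx _ e20; have [m ym] := sy _ e20.
exists (l ++ m); rewrite /ratcomb big_cat /= -/(ratcomb l) -/(ratcomb m).
rewrite opprD addrACA (le_lt_trans (ler_normD _ _))//.
by rewrite [e]splitr ltrD.
Qed.

Lemma closed_span_setZ (a : R) x :
  closed_span_set x -> closed_span_set (a *: x).
Proof.
move=> /closed_span_setP sx; apply/closed_span_setP => e e0.
(* Half of [e] pays for replacing [x] by a combination, half for replacing [a] by a rational; the
   [+ 1] avoids division by zero. *)
have [|l xl] := sx (e / 2 / (`|a| + 1)).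
  by rewrite !divr_gt0// ltr_wpDl.
set d := e / 2 / (`|ratcomb l| + 1).
have d0 : 0 < d by rewrite !divr_gt0// ltr_wpDl.
have [|q] := @rat_in_itvoo R (a - d) (a + d).
  by rewrite ltrD2l gtrN.
rewrite in_itv /= => /andP[aq qa].
have aqd : `|a - ratr q| <= d by rewrite ler_norml; lra.
exists [seq (q * p.1, p.2) | p <- l].
have -> : ratcomb [seq (q * p.1, p.2) | p <- l] = ratr q *: ratcomb l.
  rewrite /ratcomb big_map scaler_sumr; apply: eq_bigr => p _ /=.
  by rewrite rmorphM scalerA.
have -> : a *: x - ratr q *: ratcomb l =
    a *: (x - ratcomb l) + (a - ratr q) *: ratcomb l.
  by rewrite scalerBr scalerBl addrA subrK.
rewrite (le_lt_trans (ler_normD _ _))// [e]splitr ltr_leD// !normrZ.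
  apply: le_lt_trans (_ : (`|a| + 1) * `|x - ratcomb l| < _).
    by rewrite ler_wpM2r// lerDl.
  by rewrite mulrC -ltr_pdivlMr// ltr_wpDl.
apply: le_trans (_ : d * (`|ratcomb l| + 1) <= _).
  by rewrite ler_pM// lerDl.
by rewrite /d divfK// gt_eqF// ltr_wpDl.
Qed.

Lemma mem_closed_span_set j : closed_span_set (u j).
Proof.
apply/closed_span_setP => e e0; exists [:: (1, j)].
by rewrite /ratcomb big_seq1 rmorph1 scale1r subrr normr0.
Qed.

Lemma closed_span_set_neq0 (u_neq0 : exists j, u j != 0) :
  exists2 x, closed_span_set x & x != 0.
Proof. by have [j uj] := u_neq0; exists (u j) => //; exact: mem_closed_span_set. Qed.

Definition closed_span (u_neq0 : exists j, u j != 0) : subspace_of V :=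
  SubspaceOf (@closed_closure _ _) closed_span_set0 closed_span_setD
    closed_span_setZ (closed_span_set_neq0 u_neq0).

Lemma separable_closed_span (u_neq0 : exists j, u j != 0) :
  separable (subspace_type (closed_span u_neq0)).
Proof.
set S := closed_span u_neq0.
have inS l : ratcomb l \in in_subspace S.
  by apply/asboolP; apply: subset_closure; exists l.
pose D l : subspace_type S := exist _ (ratcomb l) (inS l).
exists (range D).
  exact: sub_countable (card_image_le _ _) (countableP _).
move=> O [x Ox]; rewrite openE => /(_ _ Ox)/nbhs_normP[e e0 eO].
have /closed_span_setP/(_ _ e0)[l xl] : closed_span_set (val x).
  by have /asboolP := valP x.
by exists (D l); split; [apply: eO|exists l].
Qed.

(** The preimage of [S] is closed and contains all rational combinations. This lets derivatives
    restrict to operators between the separable spans. *)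
Lemma closed_span_sub_preimage (W : normedModType R) (T : V -> W) (S : subspace_of W) :
  linear T -> continuous T -> (forall j, subspace_set S (T (u j))) ->
  forall x, closed_span_set x -> subspace_set S (T x).
Proof.
move=> linT contT Tu x; pose L := GRing.isLinear.Build R V W _ T linT.
pose T' : {linear V -> W} := HB.pack T L.
have clS : closed (T @^-1` subspace_set S).
  by apply: preimage_closed (@subspace_closed _ _ S) => y _; exact: contT.
rewrite /= /closed_span_set => /(@closureS _ _ (T @^-1` subspace_set S)).
rewrite -(proj1 (closure_id _) clS); apply => _ [l _ <-] /=.
rewrite -[T]/(T' : V -> W) /ratcomb linear_sum /=.
elim/big_ind: _ => [||p _]; first exact: subspace_set0.
  exact: subspace_setD.
by rewrite -[T]/(T' : V -> W) linearZ; apply: subspace_setZ; exact: Tu.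
Qed.

End ClosedSpan.

(** * Convergence of derivatives *)

Lemma separable_dense_seq (R : realType) (V : normedModType R) :
  separable V -> exists v : nat -> V,
    forall x (e : R), 0 < e -> exists n, `|v n - x| < e.
Proof.
move=> [D /countable_injP[phi phi_inj] dD].
have [v vP] : {v : nat -> V & forall n, forall d, D d -> phi d = n -> v n = d}.
  apply: (@choice _ _ (fun n v => forall d, D d -> phi d = n -> v = d)) => n.
  have [[d [Dd <-]]|nd] := pselect (exists d, D d /\ phi d = n).
    by exists d => c Dc /phi_inj/esym; apply; rewrite inE.
  by exists 0 => d Dd dn; case: nd; exists d.
exists v => x e e0; have [||d [+ Dd]] := dD (ball x e).
- by exists x; exact: ballxx.
- exact: ball_open.
by rewrite -ball_normE /= distrC => xd; exists (phi d); rewrite (vP _ _ Dd).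
Qed.

Lemma linear_at0 (R : realType) (V W : normedModType R) (T : V -> W) :
  linear T -> T 0 = 0.
Proof. by move=> /(_ (-1) 0 0); rewrite scaler0 addr0 scaleN1r addNr. Qed.

Lemma linear_atZ (R : realType) (V W : normedModType R) (T : V -> W) (t : R) h :
  linear T -> T (t *: h) = t *: T h.
Proof. by move=> linT; have := linT t h 0; rewrite !addr0 linear_at0 ?addr0. Qed.

Lemma linear_le_scaled (R : realType) (V W : normedModType R) (T : V -> W)
    (d K : R) : 0 < d -> linear T -> (forall h, `|h| <= d -> `|T h| <= K) ->
  forall h, `|T h| <= K / d * `|h|.
Proof.
move=> d0 linT TK h; have [->|h0] := eqVneq h 0.
  by rewrite linear_at0// !normr0 mulr0.
have h_gt0 : 0 < `|h| by rewrite normr_gt0.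
have dh_gt0 : 0 < d / `|h| by rewrite divr_gt0.
have : `|T ((d / `|h|) *: h)| <= K.
  by apply: TK; rewrite normrZ gtr0_norm// divfK// gt_eqF.
rewrite linear_atZ// normrZ gtr0_norm// -ler_pdivlMl// invf_div.
by have -> : `|h| / d * K = K / d * `|h| by ring.
Qed.

Lemma bounded_linear_cont (R : realType) (V W : normedModType R) (T : V -> W)
    (B : R) : linear T -> (forall h, `|T h| <= B * `|h|) -> continuous T.
Proof.
move=> linT TB; pose L := GRing.isLinear.Build R V W _ T linT.
pose T' : {linear V -> W} := HB.pack T L.
apply: (@bounded_linear_continuous _ _ _ T'); apply/linear_boundedP.
exists B; split; first exact: num_real.
by move=> b Bb x; rewrite (le_trans (TB x))// ler_wpM2r// ltW.
Qed.

Lemma ler_opnorm (R : realType) (V W : normedModType R) (T : clinear V W) x :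
  `|val T x| <= opnorm T * `|x|.
Proof.
have := @linear_le_scaled _ _ _ (val T) 1 (opnorm T) ltr01 (clinear_linear T).
by rewrite divr1; apply => h; exact: le_opnorm.
Qed.

Lemma clinear_restrict (R : realType) (V W : normedModType R)
    (S : subspace_of V) (S' : subspace_of W) (T : V -> W) (B : R) :
  linear T -> (forall h, `|T h| <= B * `|h|) ->
  (forall x, subspace_set S x -> subspace_set S' (T x)) ->
  exists T' : clinear (subspace_type S) (subspace_type S'),
    forall x, val (val T' x) = T (val x).
Proof.
move=> linT TB TS.
have inS' (x : subspace_type S) : T (val x) \in in_subspace S'.
  by apply/asboolP/TS; have /asboolP := valP x.
pose t (x : subspace_type S) : subspace_type S' := exist _ (T (val x)) (inS' x).
have lint : linear t by move=> a x y; apply: val_inj; rewrite /= linT.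
suff tcl : t \in @in_clinear R (subspace_type S) (subspace_type S').
  by exists (exist _ t tcl).
apply/asboolP; split=> //.
by apply: (@bounded_linear_cont _ _ _ t B) => // h; exact: TB.
Qed.

Lemma exists_small_scale (R : realType) (V : normedModType R) (h : V) (d : R) :
  0 < d -> exists2 t : R, 0 < t & `|t *: h| < d.
Proof.
move=> d0; exists (d / (`|h| + 1)); first by rewrite divr_gt0// ltr_wpDl.
rewrite normrZ gtr0_norm; last by rewrite divr_gt0// ltr_wpDl.
by rewrite mulrAC ltr_pdivrMr ?ltr_wpDl// ltr_pM2l// ltrDl.
Qed.

Lemma cvg_dist_le (R : realType) (W : normedModType R) (w : nat -> W) (l a : W)
    (B : R) (N : nat) :
  w @ \oo --> l -> (forall j, (N <= j)%N -> `|w j - a| <= B) -> `|l - a| <= B.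
Proof.
move=> /cvgrPdist_lt wl wa; apply/ler_addgt0Pl => e /wl[M _ hM].
have := hM (maxn M N) (leq_maxl _ _); have := wa (maxn M N) (leq_maxr _ _).
by have := ler_distD (w (maxn M N)) l a; rewrite /=; lra.
Qed.

(* Uniform approximation of [g (p j)] by its derivative at scale [1/(m k)]    *)
(* turns pointwise convergence of [g (p j)] into that of the derivatives.     *)
Lemma cvg_derivatives (R : realType) (E V : normedModType R)
    (W : completeNormedModType R) (g L : E -> V -> W) (p : nat -> E) (q : E)
    (m : nat -> nat) (rho M : R) :
  0 < rho -> p @ \oo --> q ->
  (forall h, `|h| < rho -> {for q, continuous (g^~ h)}) ->
  (forall j h, `|h| < rho -> `|g (p j) h| <= M) ->
  (forall j, linear (L (p j))) ->
  (forall k j h, (k < j)%N -> `|h| < (m k).+1%:R^-1 ->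
     `|g (p j) h - L (p j) h| <= k.+1%:R^-1 * `|h|) ->
  exists T : V -> W, [/\ linear T, exists B, forall h, `|T h| <= B * `|h| &
    forall h, L (p j) h @[j --> \oo] --> T h].
Proof.
move=> rho0 pq gc gM linL gL.
have scaleL j t h : L (p j) (t *: h) = t *: L (p j) h by exact: linear_atZ.
have cvgL h : cvg (L (p j) h @[j --> \oo]).
  apply/cauchy_cvgP/cauchy_exP => e e0.
  (* After scaling [h] by [t], the two linearization errors and the two distances to the limit
     [g q (t *: h)] are each at most [t * (e / 8)]. No derivative at [q] is involved. *)
  have e8 : 0 < e / (8 * (`|h| + 1)) by rewrite divr_gt0// mulr_gt0// ltr_wpDl.
  have [k hk] := exists_invSn_lt e8.
  have [|t t0] := @exists_small_scale _ _ h (Num.min rho (m k).+1%:R^-1).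
    by rewrite lt_min rho0 invr_gt0/=.
  rewrite lt_min => /andP[trho tm].
  have /cvgrPdist_lt/(_ (t * (e / 8))) : g (p j) (t *: h) @[j --> \oo] --> g q (t *: h).
    exact: (@cvg_comp _ _ _ p (g^~ (t *: h)) _ _ _ pq (gc _ trho)).
  rewrite mulr_gt0 ?divr_gt0// => /(_ isT)[N _ hN].
  exists (L (p (maxn N k.+1)) h); exists (maxn N k.+1) => // j /= jN.
  move: (jN); rewrite geq_max => /andP[Nj kj].
  rewrite -ball_normE /= -(ltr_pM2l t0) -{1}(gtr0_norm t0) -normrZ scalerBr -!scaleL.
  set n := maxn N k.+1.
  have := hN _ Nj; have := hN n (leq_maxl _ _).
  have := gL _ _ _ kj tm; have := gL _ n _ (leq_maxr _ _) tm.
  rewrite normrZ (gtr0_norm t0) /=.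
  set gj := g (p j) _; set gn := g (p n) _; set gq := g q _.
  set Lj := L (p j) _; set Ln := L (p n) _ => h1 h2 h3 h4.
  have hk' : k.+1%:R^-1 * (t * `|h|) <= t * (e / 8).
    rewrite mulrCA ler_pM2l//.
    apply: le_trans (_ : e / (8 * (`|h| + 1)) * (`|h| + 1) <= _).
      by rewrite ler_pM ?normr_ge0 ?invr_ge0 ?ler0n ?(ltW hk)// lerDl.
    by rewrite invfM mulrA divfK// gt_eqF// ltr_wpDl.
  have := ler_distD gn Ln Lj; have := ler_distD gq gn Lj.
  have := ler_distD gj gq Lj; rewrite (distrC Ln Lj) (distrC Ln gn) (distrC gn gq).
  have := le_trans h1 hk'; have := le_trans h2 hk'; move: h3 h4.
  have -> : t * e = 8 * (t * (e / 8)) by field.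
  have : 0 < t * (e / 8) by rewrite mulr_gt0// divr_gt0.
  move: (t * (e / 8)) => c; lra.
pose T h := lim (L (p j) h @[j --> \oo]).
have LT h : L (p j) h @[j --> \oo] --> T h by exact: cvgL.
exists T; split=> // [a x y|].
  have lim1 : a *: L (p j) x + L (p j) y @[j --> \oo] --> a *: T x + T y.
    exact: (cvgD (cvgZl_tmp (LT x)) (LT y)).
  have lim2 : a *: L (p j) x + L (p j) y @[j --> \oo] --> T (a *: x + y).
    by under eq_fun do rewrite -linL; exact: LT.
  exact: cvg_unique lim2 lim1.
(* Accuracy level [0] bounds [L (p j)] by [M + d] on the ball of radius [d] for all [j >= 1], and
   this uniform bound passes to the limit [T]. *)
pose d := Num.min (rho / 2) ((m 0%N).+1%:R^-1 / 2).
have m0 : 0 < (m 0%N).+1%:R^-1 :> R by rewrite invr_gt0.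
have d0 : 0 < d by rewrite lt_min !divr_gt0.
have drho : d < rho by rewrite gt_min ltr_pdivrMr// ltr_pMr// ltr1n.
have dm : d < (m 0%N).+1%:R^-1.
  by rewrite gt_min [X in _ || X]ltr_pdivrMr// ltr_pMr// ltr1n orbT.
exists ((M + d) / d) => h; rewrite -[T h]subr0.
apply: (cvg_dist_le (N := 1%N) (LT h)) => j j0; rewrite subr0.
apply: linear_le_scaled => // x xd.
have := gL 0%N j x j0 (le_lt_trans xd dm); have := gM j x (le_lt_trans xd drho).
rewrite invr1 mul1r => h1 h2.
have := ler_distD (g (p j) x) (L (p j) x) 0; rewrite !subr0 (distrC (L _ _)); lra.
Qed.

(** * Non-small sets of derivatives *)

Section Core.
Context (R : realType) (E : completeNormedModType R) (V : normedModType R)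
  (W : completeNormedModType R).
Context (strong : bool) (Z C : set E) (g L : E -> V -> W) (rho M e : R).
Hypothesis hsep : forall (S : subspace_of V) (T : subspace_of W),
  separable (subspace_type S) -> separable (subspace_type T) ->
  separable (clinear (subspace_type S) (subspace_type T)).
Hypotheses (C_closed : closed C) (ZC : Z `<=` C) (rho0 : 0 < rho) (e0 : 0 < e).
Hypothesis gC : forall x h, C x -> `|h| < rho -> {for x, continuous (g^~ h)}.
Hypothesis gM : forall x h, C x -> `|h| < rho -> `|g x h| <= M.
Hypothesis linL : forall x, Z x -> linear (L x).
Hypothesis contL : forall x, Z x -> continuous (L x).
Hypothesis gL : forall x, Z x -> forall eps : R, 0 < eps ->
  exists2 d : R, 0 < d & forall h, `|h| < d -> `|g x h - L x h| <= eps * `|h|.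
Hypothesis classL : forall x, Z x ->
  sigma_holey strong (Z `&` [set y | forall h, `|L y h - L x h| <= e * `|h|]).

Local Notation small := (sigma_holey strong).

Let D k m := [set z | Z z /\ forall h, `|h| < m.+1%:R^-1 ->
  `|g z h - L z h| <= k.+1%:R^-1 * `|h|].

(** One branching of the tree: [p] holds a vector, two children of [S], and the approximate values
    of the derivatives at that vector on each child. The level [k] controls both size and accuracy,
    and [m] serves both children. *)
Let fork (S : set E) (k : nat) (p : V * (bool -> set E) * (bool -> W)) :=
  [/\ p.1.1 != 0, e * `|p.1.1| < `|p.2 true - p.2 false|,
      exists m, forall b, p.1.2 b `<=` S `&` D k m &
      forall b, [/\ ~ small (p.1.2 b),
        exists x, forall z, p.1.2 b z -> `|z - x| < k.+1%:R^-1 &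
        forall z, p.1.2 b z -> `|L z p.1.1 - p.2 b| <= e / 8 * `|p.1.1|]].

(** Some [S1], the part of [S] with uniform accuracy at a fixed scale, is non-small, and so is its
    kernel [S2]. As classes are small, [S2] contains [x] and [y] whose derivatives differ by more
    than [e] at some vector; the children are neighbourhoods of [x] and [y] in [S1]. *)
Lemma fork_exists S k : S `<=` Z -> ~ small S -> exists p, fork S k p.
Proof.
move=> SZ nS.
have [n hn] := @exists_invSn_lt R (e / 32) (divr_gt0 e0 (ltr0n _ 32)).
set K := maxn k n.
have Kk : K.+1%:R^-1 <= k.+1%:R^-1 :> R by rewrite lef_pV2 ?posrE// ler_nat ltnS leq_maxl.
have Ke : K.+1%:R^-1 < e / 32.
  by apply: le_lt_trans hn; rewrite lef_pV2 ?posrE// ler_nat ltnS leq_maxr.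
have [m nSm] : exists m, ~ small (S `&` D K m).
  apply: contrapT => /forallNP smallS; apply: nS.
  apply: sigma_holeyS (sigma_holey_bigcup (fun m => contrapT (smallS m))).
  move=> z Sz; have K0 : 0 < K.+1%:R^-1 :> R by rewrite invr_gt0.
  have [d d0 hd] := gL (SZ _ Sz) K0; have [m hm] := exists_invSn_lt d0.
  exists m => //; split=> //; split; first exact: SZ.
  by move=> h hh; apply: hd; exact: lt_trans hm.
have S1Z : S `&` D K m `<=` Z by move=> z [_ []].
set S1 := S `&` D K m in nSm S1Z.
have nS2 := sigma_holey_kernel nSm; set S2 := S1 `&` _ in nS2.
have [x S2x] : exists x, S2 x.
  apply: contrapT => /forallNP S20; apply: nS2; apply: holey_sigma.
  by move=> x /S20.
have Zx : Z x by apply: S1Z; case: S2x.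
have [y [S2y [u]]] : exists y, S2 y /\ exists u, e * `|u| < `|L y u - L x u|.
  apply: contrapT => /forallNP far; apply: nS2.
  apply: sigma_holeyS (classL Zx) => y S2y; split; first by apply: S1Z; case: S2y.
  move=> h; rewrite leNgt; apply/negP => hfar; apply: (far y); split=> //.
  by exists h.
have Zy : Z y by apply: S1Z; case: S2y.
(* By linearity, shrinking [u] keeps the separation and brings it into the range where [g] is
   continuous and the linearization bound of [S1] applies. *)
have [|t t0] := @exists_small_scale _ _ u (Num.min rho m.+1%:R^-1).
  by rewrite lt_min rho0 invr_gt0/=.
rewrite lt_min => /andP[trho tm] xyu.
have scaleL z h : Z z -> L z (t *: h) = t *: L z h.
  by move=> Zz; apply: linear_atZ; exact: linL.
have {xyu} : e * `|t *: u| < `|L y (t *: u) - L x (t *: u)|.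
  by rewrite !scaleL// -scalerBr !normrZ (gtr0_norm t0) mulrCA ltr_pM2l.
move: (t *: u) trho tm => v vrho vm xyv.
have v_neq0 : v != 0.
  apply/eqP => v0; move: xyv; rewrite v0 normr0 mulr0 normr_gt0 subr_eq0.
  by rewrite !linear_at0 ?eqxx//; exact: linL.
have v_gt0 : 0 < `|v| by rewrite normr_gt0.
have branch z : S2 z -> exists T, [/\ T `<=` S1, ~ small T,
    exists w, forall z', T z' -> `|z' - w| < k.+1%:R^-1 &
    forall z', T z' -> `|L z' v - L z v| <= e / 8 * `|v|].
  move=> [S1z kerz]; have Zz := S1Z _ S1z.
  have /cvgrPdist_lt/(_ (e / 32 * `|v|)) := gC (ZC Zz) vrho.
  rewrite mulr_gt0 ?divr_gt0// => /(_ isT)/nbhs_normP[r r0 hr].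
  exists (S1 `&` [set y | `|y - z| < Num.min r k.+1%:R^-1]); split.
  - by move=> ? [].
  - by apply: kerz; rewrite lt_min r0 invr_gt0/=.
  - by exists z => z' [_]; rewrite /= lt_min => /andP[].
  move=> z' [[Sz' [Zz' Dz']]]; rewrite /= lt_min distrC => /andP[/hr/= gzz' _].
  case: S1z => _ [_ Dz]; have := Dz _ vm; have := Dz' _ vm.
  (* Two linearization errors and one continuity error, each at most [e / 32], stay below
     [e / 8]. *)
  have Kev : K.+1%:R^-1 * `|v| < e / 32 * `|v| by rewrite ltr_pM2r.
  have := ler_distD (g z' v) (L z' v) (L z v); have := ler_distD (g z v) (g z' v) (L z v).
  rewrite (distrC (L z' v) (g z' v)) (distrC (g z' v) (g z v)).
  rewrite (_ : e / 8 * `|v| = 4 * (e / 32 * `|v|)); last by field.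
  have : 0 < e / 32 * `|v| by rewrite mulr_gt0 ?divr_gt0.
  move: Kev gzz'; move: (K.+1%:R^-1 * `|v| : R) (e / 32 * `|v|) => a b; lra.
have [T [TS1 nT [w wP] LT]] := branch _ S2x.
have [T' [TS1' nT' [w' wP'] LT']] := branch _ S2y.
exists (v, (fun b : bool => if b then T' else T),
  (fun b : bool => if b then L y v else L x v)); split=> //=.
  exists m => -[] z /=; [move=> /TS1'|move=> /TS1] => -[Sz [Zz Dz]];
    split=> //; split=> // h hm; apply: le_trans (Dz _ hm) _; exact: ler_wpM2r.
by case; split=> //; [exists w'|exists w].
Qed.

(* Diagonalization: the branch of the tree of [fork]s is chosen against a     *)
(* dense sequence of operators between the closed spans of the whole tree.    *)
Lemma sigma_holey_of_classes : small Z.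
Proof.
apply: contrapT => nZ.
have [fk fkP] : {fk : set E * nat -> V * (bool -> set E) * (bool -> W) &
    forall Sk, Sk.1 `<=` Z -> ~ small Sk.1 -> fork Sk.1 Sk.2 (fk Sk)}.
  apply: (@choice _ _ (fun (Sk : set E * nat) p =>
    Sk.1 `<=` Z -> ~ small Sk.1 -> fork Sk.1 Sk.2 p)) => Sk.
  have [SZ|?] := pselect (Sk.1 `<=` Z); last by exists (0, fun=> set0, fun=> 0).
  have [?|nS] := pselect (small Sk.1); first by exists (0, fun=> set0, fun=> 0).
  by have [p] := fork_exists Sk.2 SZ nS; exists p.
(* A node is addressed by its choices, latest first; its depth [size s] is the level of accuracy of
   its fork. *)
pose node := fix node s :=
  if s is b :: s' then (fk (node s', size s')).1.2 b else Z.
have nodeP s : node s `<=` Z /\ ~ small (node s).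
  elim: s => [|b s [sZ ns]] /=; first by split.
  have [_ _ [m mP] /(_ b)[nb _ _]] := fkP (node s, size s) sZ ns.
  by split=> // z /mP[/sZ].
have nodeZ s : node s `<=` Z by case: (nodeP s).
pose u s := (fk (node s, size s)).1.1; pose a s := (fk (node s, size s)).2.
have forkP s : fork (node s) (size s) (fk (node s, size s)).
  by apply: fkP; case: (nodeP s).
have [pt ptP] : {pt : seq bool -> E & forall s, node s (pt s)}.
  apply: (@choice _ _ (fun s x => node s x)) => s.
  apply: contrapT => /forallNP s0; case: (nodeP s) => _; apply.
  by apply: holey_sigma => x /s0.
have linpt s : linear (L (pt s)) by apply: linL; exact/nodeZ.
have u_neq0 s : u s != 0 by case: (forkP s).
have u_ex : exists s, u s != 0 by exists [::].
(* All derivatives at all vectors of the tree are included, so that every [L (pt s)] maps the span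
   of [u] into the span of [v], whichever branch is chosen later. *)
pose v (p : seq bool * seq bool) := L (pt p.1) (u p.2).
have v_ex : exists p, v p != 0.
  apply: contrapT => /forallNP v0.
  have Lu0 b : L (pt [:: b]) (u [::]) = 0.
    by apply/eqP/negPn/negP; exact: (v0 ([:: b], [::])).
  have [_ far _ near] := forkP [::].
  have [_ _ /(_ _ (ptP [:: true]))] := near true.
  have [_ _ /(_ _ (ptP [:: false]))] := near false.
  rewrite -/(u [::]) !Lu0 !sub0r !normrN => h1 h2.
  have : 0 < e * `|u [::]| by rewrite mulr_gt0// normr_gt0.
  have := ler_normB (a [::] true) (a [::] false); move: far h1 h2.
  rewrite -/(u [::]) -/(a [::]) (_ : e / 8 * `|u [::]| = e * `|u [::]| / 8); last by ring.
  move: (e * _ : R) => c; lra.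
pose Xt := closed_span u_ex; pose Yt := closed_span v_ex.
have [T Tdense] := separable_dense_seq
  (hsep (separable_closed_span u_ex) (separable_closed_span v_ex)).
have inXt s : u s \in in_subspace Xt by apply/asboolP; exact: mem_closed_span_set.
pose ut s : subspace_type Xt := exist _ (u s) (inXt s).
(* The two values at a fork are more than [e] apart (relative to the vector), so any [w] is at least
   [e / 2] away from one of them. *)
have [beta betaP] : {beta : seq bool * W -> bool & forall sw,
    e / 2 * `|u sw.1| <= `|sw.2 - a sw.1 (beta sw)|}.
  apply: (@choice _ _ (fun (sw : seq bool * W) b =>
    e / 2 * `|u sw.1| <= `|sw.2 - a sw.1 b|)) => -[s w] /=; have [_ + _ _] := forkP s.
  rewrite -/(u s) -/(a s).
  have := ler_distD w (a s true) (a s false); rewrite (distrC _ w) => h1 h2.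
  have [h3|h3] := leP (e / 2 * `|u s|) `|w - a s true|; first by exists true.
  exists false; move: h1 h2 h3.
  rewrite (_ : e / 2 * `|u s| = e * `|u s| / 2); last by ring.
  move: (e * _ : R) => c; lra.
pose br := fix br j := if j is j'.+1
  then beta (br j', val (val (T j') (ut (br j')))) :: br j' else [::].
have size_br j : size (br j) = j by elim: j => //= j ->.
have br_sub j l : (j <= l)%N -> node (br l) `<=` node (br j).
  move=> /subnK <-; elim: (l - j)%N => [//|i IH]; rewrite addSn => z /= Hz.
  by apply: IH; have [_ _ [m mP] _] := forkP (br (i + j)%N); have [] := mP _ _ Hz.
pose p j := pt (br j).
have pnode j l : (j <= l)%N -> node (br j) (p l).
  by move=> jl; apply: (br_sub _ _ jl); exact: ptP.
have pZ j : Z (p j) by apply: nodeZ; exact: ptP.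
(* All [p j] with [j > k] lie in the child chosen at level [k], hence share its scale. *)
have [m mP] : {m : nat -> nat & forall k j, (k < j)%N -> D k (m k) (p j)}.
  apply: (@choice _ _ (fun k m => forall j, (k < j)%N -> D k m (p j))) => k.
  have [_ _ [m mP] _] := forkP (br k); exists m => j /pnode /= Hp.
  by have [_] := mP _ _ Hp; rewrite size_br.
have cvgp : cvg (p @ \oo).
  apply/cauchy_cvgP/cauchy_exP => r r0; have [k hk] := exists_invSn_lt r0.
  have [_ _ _ /(_ (beta (br k, val (val (T k) (ut (br k))))))[_ [x xP] _]] := forkP (br k).
  exists x; exists k.+1 => // j /pnode /= /xP; rewrite size_br => px.
  by rewrite -ball_normE /= distrC (lt_trans px).
have Cq : C (lim (p @ \oo)).
  by apply: (closed_cvg C C_closed _ _ cvgp); apply: nearW => j; exact/ZC/pZ.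
have [Lam [linLam [B LamB] LamL]] := @cvg_derivatives R E V W g L p _ m rho M
  rho0 cvgp (fun h => gC Cq) (fun j h => gM (ZC (pZ j))) (fun j => linL (pZ j))
  (fun k j h kj => (mP k j kj).2 h).
have LamXY x : subspace_set Xt x -> subspace_set Yt (Lam x).
  move=> Xx; apply: (closed_cvg (subspace_set Yt) (@subspace_closed _ _ Yt) _ _ (LamL x)).
  apply: nearW => j; apply: closed_span_sub_preimage Xx.
  - exact: linpt.
  - exact: contL.
  - by move=> s; exact: (@mem_closed_span_set R W _ v (br j, s)).
have [S SLam] := clinear_restrict linLam LamB LamXY.
(* At the vector of level [j], [T j] is within [e / 4] of the limit operator, which is within
   [e / 8] of the value on the chosen child; but that child was chosen at distance at least [e / 2]
   from [T j]. *)
have [j hj] := Tdense S _ (divr_gt0 e0 (ltr0n R 4)).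
have h1 : `|val (val (T j) (ut (br j))) - Lam (u (br j))| <= e / 4 * `|u (br j)|.
  have -> : Lam (u (br j)) = val (val S (ut (br j))) by rewrite SLam.
  apply: le_trans (ler_opnorm (T j - S) (ut (br j))) _.
  by rewrite ler_wpM2r// ltW.
have := betaP (br j, val (val (T j) (ut (br j)))).
set b := beta _ => /= h2.
have h3 : `|Lam (u (br j)) - a (br j) b| <= e / 8 * `|u (br j)|.
  apply: (cvg_dist_le (N := j.+1) (LamL _)) => l /pnode jl.
  by have [_ _ _ /(_ b)[_ _]] := forkP (br j); apply.
have := ler_distD (Lam (u (br j))) (val (val (T j) (ut (br j)))) (a (br j) b).
have : 0 < e * `|u (br j)| by rewrite mulr_gt0// normr_gt0.
move: h1 h2 h3; rewrite ![e / _ * _]mulrAC; move: (e * _ : R) => c; lra.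
Qed.

End Core.

(** * Product spaces *)

Lemma differentiableE (R : realType) (V W : normedModType R) (F : V -> W) a :
  differentiable F a <-> exists T : V -> W, [/\ linear T, continuous T &
    forall e : R, 0 < e -> exists2 d : R, 0 < d &
      forall h, `|h| < d -> `|F (a + h) - F a - T h| <= e * `|h|].
Proof.
split=> [dF|[T [linT contT TF]]].
  exists ('d F a); split.
  - exact: linearP.
  - exact: diff_continuous.
  move=> e e0; have /eqaddoP/(_ e e0)/nbhs_norm0P[d /= d0 hd] := diff_locally dF.
  exists d => // h /hd /=; rewrite !fctE /= [h + a]addrC opprD addrA.
  exact.
pose L := GRing.isLinear.Build R V W _ T linT.
pose T' : {linear V -> W} := HB.pack T L.
have T'F : F \o shift a = cst (F a) + T' +o_ 0 id.
  apply/eqaddoP => e /TF[d d0 hd]; apply/nbhs_norm0P; exists d => //= h /hd.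
  by rewrite !fctE /= [h + a]addrC opprD addrA.
by apply/diff_locallyP; rewrite (@diff_unique _ _ _ _ T' _ contT T'F).
Qed.

Lemma ler_norm_coord (R : realType) (I : finType) (X : I -> normedModType R)
    (x : maxprod X) i : `|x i| <= `|x|.
Proof. exact: le_maxprod_norm. Qed.

Section MaxProdComplete.
Context (R : realType) (I : finType) (X : I -> completeNormedModType R).

(** Completeness of the product provides the limit point of a branch of the tree. *)
Fact cauchy_cvg_maxprod (F : set_system (maxprod X)) :
  ProperFilter F -> cauchy F -> cvg F.
Proof.
move=> FF /cauchyP Fc.
have coord_cvg i : cvg ((fun x : maxprod X => x i) @ F).
  apply/cauchy_cvgP/cauchy_exP => e /Fc[x Fx]; exists (x i).
  rewrite /fmap; apply: (@filterS _ F _ _ _ _ Fx) => y.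
  rewrite -!ball_normE /=; apply: le_lt_trans.
  exact: (@ler_norm_coord R I X (x - y) i).
pose l : maxprod X := fun i => lim ((fun x : maxprod X => x i) @ F).
apply/cvg_ex; exists l; apply/cvgrPdist_le => e e0.
have : \forall x \near F, forall i, `|l i - x i| <= e.
  apply: filter_forall => i.
  by have /cvgrPdist_le/(_ e e0) := coord_cvg i.
apply: filterS => x lx; apply: bigmax_le => [|i _]; first exact: ltW.
exact: lx.
Qed.

HB.instance Definition _ :=
  Uniform_isComplete.Build (maxprod X) cauchy_cvg_maxprod.

End MaxProdComplete.

Section Axis.
Context (R : realType) (I : finType) (X : I -> normedModType R).

Definition axis (i : I) (h : X i) : maxprod X := dfwith (0 : maxprod X) i h.

Lemma norm_axis i (h : X i) : `|axis h| <= `|h|.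
Proof.
apply: bigmax_le => // j _; rewrite /axis.
by case: dfwithP => // k _; rewrite normr0.
Qed.

Lemma axis0 i : axis (0 : X i) = 0.
Proof. by apply/eqP; rewrite -normr_le0 -[leRHS](normr0 (X i)) norm_axis. Qed.

Lemma dfwith_axis (x : maxprod X) i (t : X i) :
  dfwith x i t = x + axis (t - x i).
Proof.
apply: functional_extensionality_dep => j.
rewrite -[RHS]/(x j + axis (t - x i) j) /axis.
case: dfwithP => [|k ik]; first by rewrite dfwithin addrC subrK.
by rewrite dfwithout// addr0.
Qed.

Lemma continuous_coord i : continuous (fun h : maxprod X => h i).
Proof.
apply: (@bounded_linear_cont _ _ _ (fun h : maxprod X => h i) 1) => // h.
by rewrite mul1r; exact: ler_norm_coord.
Qed.

End Axis.

(** * Strong partial derivatives *)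

Section StrongPartials.
Context (R : realType) (I : finType) (X : I -> completeNormedModType R)
  (Y : completeNormedModType R).
Local Notation E := (maxprod X).
Context (G : set E) (f : E -> Y).
Implicit Types (x t y : E) (i : I).

Definition partial_derivative i x (T : X i -> Y) :=
  [/\ linear T, continuous T & forall e : R, 0 < e -> exists2 d : R, 0 < d &
    forall h, `|h| < d -> `|f (x + axis h) - f x - T h| <= e * `|h|].

(** Allowing the error [|t - x|] is harmless when increments are summed, and gives a failure enough
    slack to persist on a ball around [t]. *)
Definition strong_partial_derivative i x (T : X i -> Y) :=
  forall e : R, 0 < e -> exists2 d : R, 0 < d &
    forall t h, `|t - x| < d -> `|h| < d ->
      `|f (t + axis h) - f t - T h| <= e * (`|h| + `|t - x|).

Lemma partially_differentiableE i x : partially_differentiable f i x ->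
  exists T, partial_derivative x (T : X i -> Y).
Proof.
move=> /differentiableE[T [linT contT TF]]; exists T; split=> // e /TF[d d0 hd].
exists d => // h /hd; rewrite !dfwith_axis subrr axis0 addr0.
by rewrite [x i + h]addrC addrK.
Qed.

Context (strong : bool) (K : R).
Hypothesis G_open : open G.
Hypothesis contf : forall x, G x -> {for x, continuous f}.
Hypothesis lipf : strong ->
  forall x y, G x -> G y -> `|f x - f y| <= K * `|x - y|.

(** This separates porosity from nowhere density: a Lipschitz [f] gives a radius proportional to [s]
    with a ratio depending on [e] and [K] only, while continuity gives some positive radius. *)
Lemma stable_radius i (e : R) : 0 < e -> exists2 c : R, 0 < c &
  forall t (h : X i) (s : R), 0 < s ->
    (forall y, `|y - t| < s -> G y /\ G (y + axis h)) ->
    exists r : R, [/\ 0 < r <= s, strong -> c * s <= r & forall y, `|y - t| < r ->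
      `|(f (y + axis h) - f y) - (f (t + axis h) - f t)| <= e * s].
Proof.
move=> e0; pose K' := `|K| + 1; have K'0 : 0 < K' by rewrite ltr_wpDl.
pose c := Num.min 1 (e / (2 * K')).
have c0 : 0 < c by rewrite lt_min ltr01 divr_gt0// mulr_gt0.
have c1 : c <= 1 by rewrite ge_min lexx.
exists c => // t h s s0 Gs; have [Gt Gth] : G t /\ G (t + axis h).
  by apply: Gs; rewrite subrr normr0.
have diffE y : f (y + axis h) - f y - (f (t + axis h) - f t) =
    (f (y + axis h) - f (t + axis h)) - (f y - f t).
  by rewrite [in LHS]opprD addrACA -opprD.
have [st|nst] := boolP strong.
  exists (c * s); split=> //.
    by rewrite mulr_gt0//= ler_piMl// ltW.
  move=> y yt; have ys : `|y - t| < s.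
    by rewrite (lt_le_trans yt)// ler_piMl// ltW.
  have [Gy Gyh] := Gs _ ys; rewrite diffE (le_trans (ler_normB _ _))//.
  have := lipf st Gy Gt; have := lipf st Gyh Gth.
  rewrite opprD addrACA subrr addr0 => h1 h2.
  have Kc z : 0 <= z -> z < c * s -> K * z <= e * s / 2.
    move=> z0 zc; apply: le_trans (_ : K' * (c * s) <= _).
      apply: le_trans (_ : K' * z <= _); last by rewrite ler_pM2l// ltW.
      by rewrite ler_wpM2r// (le_trans (ler_norm _))// lerDl.
    apply: le_trans (_ : K' * (e / (2 * K') * s) <= _).
      by rewrite ler_pM2l// ler_wpM2r ?ge_min ?lexx ?orbT// ltW.
    have -> : K' * (e / (2 * K') * s) = e * s / 2 by field; rewrite gt_eqF.
    exact: lexx.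
  have := Kc _ (normr_ge0 _) yt; lra.
have s20 : 0 < e * s / 2 by rewrite divr_gt0// mulr_gt0.
have /cvgrPdist_lt/(_ _ s20)/nbhs_normP[r1 /= r10 hr1] := contf Gt.
have /cvgrPdist_lt/(_ _ s20)/nbhs_normP[r2 /= r20 hr2] := contf Gth.
exists (Num.min s (Num.min r1 r2)); split.
- by rewrite !lt_min s0 r10 r20 ge_min lexx.
- by move=> st; case/negP: nst.
move=> y; rewrite !lt_min => /and3P[_ y1 y2]; rewrite diffE.
rewrite (le_trans (ler_normB _ _))// [e * s]splitr lerD//.
  rewrite distrC; apply/ltW/hr2; rewrite /= distrC.
  by rewrite opprD addrACA subrr addr0.
by rewrite distrC; apply/ltW/hr1; rewrite /= distrC.
Qed.

(** Fix the tolerance [e] of the failure and a scale at which the expansion at the point itself has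
    error at most [e / 2]. Then each class of derivatives within [e / 4] of a given one has holes,
    and the separable reduction applies locally. *)
Lemma not_strong_small i :
  (forall (S : subspace_of (X i)) (T : subspace_of Y),
    separable (subspace_type S) -> separable (subspace_type T) ->
    separable (clinear (subspace_type S) (subspace_type T))) ->
  sigma_holey strong [set x | G x /\ exists T : X i -> Y,
    partial_derivative x T /\ ~ strong_partial_derivative x T].
Proof.
move=> hsep; set N := [set x | _].
pose g x (h : X i) := f (x + axis h) - f x.
have [L LP] : {L : E -> X i -> Y & forall x, N x ->
    partial_derivative x (L x) /\ ~ strong_partial_derivative x (L x)}.
  apply: (@choice _ _ (fun x (T : X i -> Y) => N x ->
    partial_derivative x T /\ ~ strong_partial_derivative x T)) => x.
  by have [[_ [T HT]]|nN] := pselect (N x); [exists T|exists (fun=> 0)].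
pose bad k := [set x | N x /\ forall d : R, 0 < d -> exists t h,
  [/\ `|t - x| < d, `|h| < d &
    k.+1%:R^-1 * (`|h| + `|t - x|) < `|g t h - L x h|]].
pose near k m := [set x | forall h, `|h| < m.+1%:R^-1 ->
  `|g x h - L x h| <= k.+1%:R^-1 / 2 * `|h|].
apply: (@sigma_holeyS _ _ _ _ (\bigcup_k \bigcup_m (bad k `&` near k m))).
  move=> x Nx; have [[linL _ LL] nstrong] := LP _ Nx.
  move/existsNP: nstrong => [e /not_implyP[e0 /forall2NP hd]].
  have [k hk] := exists_invSn_lt e0; exists k => //.
  have k20 : 0 < k.+1%:R^-1 / 2 :> R by rewrite divr_gt0// invr_gt0.
  have [d d0 hd'] := LL _ k20; have [m hm] := exists_invSn_lt d0.
  exists m => //; split; last by move=> h hh; apply: hd'; exact: lt_trans hm.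
  split=> // d' d'0; have [//|] := hd d'.
  move=> /existsNP[t /existsNP[h /not_implyP[tx /not_implyP[hd'' /negP]]]].
  rewrite -ltNge => far; exists t, h; split=> //; apply: le_lt_trans far.
  by rewrite ler_wpM2r ?addr_ge0// ltW.
apply: sigma_holey_bigcup => k; apply: sigma_holey_bigcup => m.
set A := bad k `&` near k m; pose e : R := k.+1%:R^-1.
have e0 : 0 < e by rewrite invr_gt0.
have AG x : A x -> G x by case=> -[[]].
have Gball x : G x -> exists2 r : R, 0 < r & forall y, `|y - x| < r -> G y.
  move: G_open; rewrite openE => /(_ x)/[apply]/nbhs_normP[r r0 hr].
  by exists r => // y yx; apply: hr; rewrite /= distrC.
have holeyA x0 : holey strong
    (A `&` [set y | forall h, `|L y h - L x0 h| <= e / 4 * `|h|]).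
  move=> x [Ax Lx]; have [r r0 xG] := Gball _ (AG _ Ax).
  have [c c0 hc] := stable_radius i e0; exists c => // d d0.
  case: (Ax) => -[Nx xbad] xnear.
  have [|t [h [tx hx far]]] := xbad (Num.min d (Num.min m.+1%:R^-1 (r / 4))).
    by rewrite !lt_min d0 invr_gt0 ltr0n divr_gt0.
  move: tx hx; rewrite !lt_min => /and3P[td tm tr] /and3P[hd hm hr].
  (* The failure cannot occur at [t = x], where the error is at most half the tolerance. *)
  have s0 : 0 < `|t - x|.
    rewrite normr_gt0 subr_eq0; apply/eqP => tx.
    move: far; rewrite tx subrr normr0 addr0 ltNge => /negP; apply.
    apply: le_trans (xnear _ hm) _; rewrite ler_wpM2r//.
    by rewrite ler_piMr// ?invf_le1 ?ler1n// ltW.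
  have [|s [s_bd cs hs]] := hc t h _ s0.
    move=> y yt; have yx : `|y - x| < r / 2.
      have := ler_distD t y x; lra.
    split; first by apply: xG; lra.
    apply: xG; rewrite addrAC (le_lt_trans (ler_normD _ _))//.
    have := @norm_axis R I X i h; lra.
  (* For [y] in the class, the errors [e / 2] (expansion at [y]) and [e / 4] twice (both derivatives
     against [L x0]) add up to [e * |h|]; the change from [y] to [t] costs [e * |t - x|],
     contradicting the failure. *)
  exists t, s; split=> // y ys [[[Ny _] ynear] Ly].
  have := hs _ ys; have := ynear _ hm; have := Ly h; have := Lx h.
  move: far; rewrite -/(g y h) -/(g t h) -/e mulrDr => far Lxh Lyh yh yt.
  have := ler_distD (g y h) (g t h) (L x h).
  have := ler_distD (L y h) (g y h) (L x h).
  have := ler_distD (L x0 h) (L y h) (L x h).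
  rewrite (distrC (L x0 h)) (distrC (g t h) (g y h)).
  move: yh Lxh Lyh; rewrite ![e / _ * _]mulrAC.
  move: far yt; move: (e * _ : R) (e * _ : R) => a b; lra.
apply: sigma_holey_local => x Ax; have Gx := AG _ Ax.
have [r1 r10 xG] := Gball _ Gx.
have /cvgrPdist_lt/(_ _ ltr01)/nbhs_normP[r2 /= r20 hr2] := contf Gx.
(* All points [y] and [y + axis h] in play then stay in [G] with values of [f] within [1] of [f x],
   so increments are bounded by [2]. *)
pose rho := Num.min (r1 / 4) (r2 / 4).
have rho0 : 0 < rho by rewrite lt_min !divr_gt0.
have rho1 : rho <= r1 / 4 by rewrite ge_min lexx.
have rho2 : rho <= r2 / 4 by rewrite ge_min lexx orbT.
pose C := closed_ball_ Num.norm x rho : set E.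
have CG y (h : X i) : C y -> `|h| < rho -> [/\ G y, G (y + axis h),
    `|f x - f y| < 1 & `|f x - f (y + axis h)| < 1].
  rewrite /C /closed_ball_ /= distrC => yx hh; have yhx : `|y + axis h - x| < 2 * rho.
    rewrite addrAC (le_lt_trans (ler_normD _ _))//.
    by have := @norm_axis R I X i h; lra.
  have xf z : `|z - x| < r2 -> `|f x - f z| < 1.
    by move=> zx; apply: hr2; rewrite /= distrC.
  by split; [apply: xG|apply: xG|apply: xf|apply: xf]; lra.
exists rho => //; apply: (@sigma_holey_of_classes R E (X i) Y strong _ C g L rho 2 (e / 4)) => //.
- exact: closed_closed_ball_.
- by move=> y [_ /= yx]; rewrite /C /closed_ball_ /= distrC; apply: ltW.
- by rewrite divr_gt0.
- move=> y h Cy hh; have [Gy Gyh _ _] := CG _ _ Cy hh.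
  have shift_cvg : (z + axis h) @[z --> y] --> y + axis h.
    exact: (cvgD cvg_id (cvg_cst _)).
  exact: (cvgB (@cvg_comp _ _ _ (fun z : E => z + axis h) f _ _ _
    shift_cvg (contf Gyh)) (contf Gy)).
- move=> y h Cy hh; have [_ _ h1 h2] := CG _ _ Cy hh.
  by have := ler_distD (f x) (f (y + axis h)) (f y); rewrite (distrC _ (f x)) /g; lra.
- by move=> y [[[/LP[[]]]]].
- by move=> y [[[/LP[[]]]]].
- by move=> y [[[/LP[[_ _ +] _]]]].
- move=> y _; apply: holey_sigma; apply: holeyS (holeyA y) => z [[Az _] Lz].
  by split.
Qed.

End StrongPartials.

(** * Differentiability *)

Lemma lipschitz_open_continuous (R : realType) (V W : normedModType R)
    (G : set V) (f : V -> W) (K : R) : open G -> 0 < K ->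
  (forall x y, G x -> G y -> `|f x - f y| <= K * `|x - y|) ->
  forall x, G x -> {for x, continuous f}.
Proof.
move=> hG K0 lipK x Gx; apply/cvgrPdist_lt => e e0.
move: (hG); rewrite openE => /(_ x Gx)/nbhs_normP[r /= r0 hr].
apply/nbhs_normP; exists (Num.min r (e / K)) => /=.
  by rewrite lt_min r0 divr_gt0.
move=> y /=; rewrite lt_min => /andP[xr xe].
by rewrite (le_lt_trans (lipK _ _ Gx (hr _ xr)))// mulrC -ltr_pdivlMr.
Qed.

Section Telescope.
Context (R : realType) (n : nat) (X : 'I_n.+1 -> completeNormedModType R)
  (Y : completeNormedModType R) (f : maxprod X -> Y).
Local Notation E := (maxprod X).

Definition tail (j : nat) (h : E) : E := fun i => if (j <= i)%N then h i else 0.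

Lemma norm_tail j h : `|tail j h| <= `|h|.
Proof.
apply: bigmax_le => // i _; rewrite /tail; case: ifP => _.
  exact: (@ler_norm_coord R _ X h i).
by rewrite normr0.
Qed.

Lemma tail0 h : tail 0 h = h.
Proof. exact: functional_extensionality_dep. Qed.

Lemma tail_last h : tail n.+1 h = 0.
Proof.
apply: functional_extensionality_dep => i.
by rewrite /tail leqNgt ltn_ord.
Qed.

Lemma tail_axis h (j : 'I_n.+1) : tail j h = tail j.+1 h + axis (h j).
Proof.
apply: functional_extensionality_dep => i.
rewrite -[RHS]/(tail j.+1 h i + axis (h j) i) /tail /axis.
case: dfwithP => [|k jk]; first by rewrite leqnn ltnn add0r.
by rewrite addr0 ltn_neqAle jk.
Qed.

(* The coordinates are switched on from the last one to the first one, so     *)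
(* that the last partial derivative is only used at [x] itself.               *)
Lemma strong_partials_differentiable (x : E) :
  (forall j, partially_differentiable f j x) ->
  (forall j : 'I_n.+1, (j < n)%N -> forall T : X j -> Y,
     partial_derivative f x T -> strong_partial_derivative f x T) ->
  differentiable f x.
Proof.
move=> pf strongf; apply/differentiableE.
have [T TP] : {T : forall j, X j -> Y & forall j, partial_derivative f x (T j)}.
  have ex j : exists T, partial_derivative f x (T : X j -> Y).
    exact: partially_differentiableE.
  by exists (fun j => projT1 (cid (ex j))) => j; exact: (projT2 (cid (ex j))).
pose S (h : E) : Y := \sum_j T j (h j).
have step (e : R) : 0 < e -> exists2 d : R, 0 < d & forall (j : 'I_n.+1) h,
    `|h| < d -> `|f (x + tail j h) - f (x + tail j.+1 h) - T j (h j)| <= e * `|h|.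
  move=> e0; have e20 : 0 < e / 2 by rewrite divr_gt0.
  have step1 (j : 'I_n.+1) : exists d : R, 0 < d /\ forall h, `|h| < d ->
      `|f (x + tail j h) - f (x + tail j.+1 h) - T j (h j)| <= e * `|h|.
    have [jn|nj] := ltnP j n.
      (* The moving base point is [x + tail j.+1 h]; its displacement and [h j] are both at most
         [|h|], whence [e / 2]. *)
      have [d d0 hd] := strongf j jn (T j) (TP j) _ e20; exists d; split=> // h hh.
      have hj := @ler_norm_coord R _ X h j; have ht := norm_tail j.+1 h.
      have := hd (x + tail j.+1 h) (h j).
      rewrite addrAC subrr add0r -[x + _ + axis _]addrA -tail_axis.
      move=> /(_ (le_lt_trans ht hh) (le_lt_trans hj hh)) /le_trans; apply.
      have -> : e * `|h| = e / 2 * (`|h| + `|h|) by field.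
      by rewrite ler_wpM2l ?lerD// ltW.
    have jE : tail j.+1 = fun=> 0.
      have -> : j.+1 = n.+1 by apply/eqP; rewrite eqSS eqn_leq nj -ltnS ltn_ord.
      by apply/funext => h; rewrite tail_last.
    have [_ _ /(_ e e0)[d d0 hd]] := TP j; exists d; split=> // h hh.
    have hj := @ler_norm_coord R _ X h j.
    rewrite tail_axis jE add0r addr0 (le_trans (hd _ (le_lt_trans hj hh)))//.
    by rewrite ler_wpM2l// ltW.
  have [d dP] := choice step1.
  exists (\big[Num.min/1]_j d j).
    by apply: lt_bigmin => // j _; case: (dP j).
  move=> j h hh; have [_] := dP j; apply; apply: lt_le_trans hh _.
  exact: bigmin_le.
exists S; split.
- move=> a u v; rewrite /S scaler_sumr -big_split; apply: eq_bigr => j _ /=.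
  by have [linT _ _] := TP j; exact: linT.
- apply: (@continuous_big Y 'I_n.+1 +%R 0 xpredT _ E _
    (fun j (h : E) => T j (h j))); first exact: add_continuous.
  move=> j _ u.
  have [_ contT _] := TP j.
  apply: (@cvg_comp _ _ _ (fun h : E => h j) (T j)); last exact: contT.
  exact: (@continuous_coord R _ X j u).
move=> e e0; have [|d d0 hd] := step (e / n.+1%:R); first by rewrite divr_gt0.
exists d => // h hh.
have -> : f (x + h) - f x = \sum_(j < n.+1) (f (x + tail j h) - f (x + tail j.+1 h)).
  rewrite -(big_mkord xpredT (fun j => f (x + tail j h) - f (x + tail j.+1 h))).
  rewrite (telescope_sumr_eq (fun j => - f (x + tail j h)))//.
    by rewrite tail0 tail_last addr0 opprK addrC.
  by move=> j _; rewrite opprK addrC.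
rewrite -sumrB (le_trans (ler_norm_sum _ _ _))//.
apply: le_trans (_ : \sum_(j < n.+1) e / n.+1%:R * `|h| <= _).
  by apply: ler_sum => j _; exact: hd.
by rewrite sumr_const card_ord -[_ *+ _]mulr_natr mulrAC divfK// pnatr_eq0.
Qed.
Lemma exceptional_small (G : set E) (strong : bool) (K : R) :
  (forall i : 'I_n.+1, (i < n)%N ->
    forall (S : subspace_of (X i)) (T : subspace_of Y),
      separable (subspace_type S) -> separable (subspace_type T) ->
      separable (clinear (subspace_type S) (subspace_type T))) ->
  open G -> (forall x, G x -> {for x, continuous f}) ->
  (strong -> forall x y, G x -> G y -> `|f x - f y| <= K * `|x - y|) ->
  sigma_holey strong [set x | [/\ G x,
    forall i, partially_differentiable f i x & ~ differentiable f x]].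
Proof.
move=> hsep oG contf lipf.
pose bad (j : 'I_n.+1) := [set x | G x /\ exists T : X j -> Y,
  partial_derivative f x T /\ ~ strong_partial_derivative f x T].
(* The finite union is indexed by [nat], padded with empty sets; the last coordinate also
   contributes nothing. *)
pose B (k : nat) : set E := if (insub k : option 'I_n.+1) is Some j then
  if (j < n)%N then bad j else set0 else set0.
have hole0 : sigma_holey strong (set0 : set E) by apply: holey_sigma => x.
apply: (@sigma_holeyS _ _ _ _ (\bigcup_k B k)).
  move=> x [Gx pf ndf]; apply: contrapT => nB; apply: ndf.
  apply: strong_partials_differentiable => // j jn T pT.
  apply: contrapT => nT; apply: nB; exists (j : nat) => //.
  by rewrite /B valK jn; split=> //; exists T.
apply: sigma_holey_bigcup => k; rewrite /B; case: insubP => // j _ _.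
case: ifP => // jn; apply: (@not_strong_small _ _ _ _ G f strong K) => //.
exact: hsep.
Qed.

End Telescope.

Theorem theorem6p7 (R : realType) (n : nat)
    (X : 'I_n.+1 -> completeNormedModType R) (Y : completeNormedModType R)
    (hX : forall i, exists x : X i, x != 0) (hY : exists y : Y, y != 0)
    (hsep : forall i : 'I_n.+1, (i < n)%N ->
      forall (S : subspace_of (X i)) (T : subspace_of Y),
        separable (subspace_type S) -> separable (subspace_type T) ->
        separable (clinear (subspace_type S) (subspace_type T)))
    (G : set (maxprod X)) (hG : open G) (f : maxprod X -> Y) :
  ({within G, continuous f} ->
   exists A : set (maxprod X),
     [/\ A `<=` G, first_category A &
         forall x, (G `\` A) x ->
           (forall i, partially_differentiable f i x) -> differentiable f x])
  /\
  ([lipschitz f x | x in G] ->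
   exists A : set (maxprod X),
     [/\ A `<=` G, sigma_porous A &
         forall x, (G `\` A) x ->
           (forall i, partially_differentiable f i x) -> differentiable f x]).
Proof.
(* Taking [A] to be exactly the set of failures makes the implication immediate and serves both
   cases. *)
set A := [set x | [/\ G x,
  forall i, partially_differentiable f i x & ~ differentiable f x]].
have AG : A `<=` G by move=> x [].
have Adiff x : (G `\` A) x ->
    (forall i, partially_differentiable f i x) -> differentiable f x.
  by move=> [Gx nA] pf; apply: contrapT => ndf; apply: nA.
split=> [contf|lipf]; exists A; split=> //.
  have [F hF AE] : sigma_holey false A.
    apply: (@exceptional_small _ _ _ _ _ _ _ 0) => // x Gx.
    by move: contf; rewrite continuous_open_subspace// => /(_ x); apply; rewrite inE.
  by exists F => // k; exact: holey_nowhere_dense (hF k).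
have [K [K0 lipK]] : exists K : R, 0 < K /\
    forall x y, G x -> G y -> `|f x - f y| <= K * `|x - y|.
  have /pinfty_ex_gt0[K K0 lipK] := lipf.
  by exists K; split=> // x y Gx Gy; exact: (lipK (x, y)).
have [F hF AE] : sigma_holey true A.
  apply: (@exceptional_small _ _ _ _ _ _ _ K) => // x Gx.
  exact: (@lipschitz_open_continuous R (maxprod X) Y G f K hG K0 lipK x Gx).
by exists F => // k; exact: holey_porous (hF k).
Qed.
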